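(* Let $G\sim G(n,\tfrac12)$ and let $N_x(G)$ be the number of $x$-cliques in $G$. For all $\epsilon\in(0,1)$ and all nonnegative integers $x$, if $n>x^2(2e-e\ln\epsilon)(2e+2-e\ln\epsilon)$ then $$\Pr\left[\left|N_x(G)-2^{-\binom{x}{2}}\binom{n}{x}\right|>e(2-\ln\epsilon)\frac{x^2}{x!}n^{x-1}\right]<\epsilon.$$
   Context: $G(n,\tfrac12)$ is the Erdős–Rényi random graph on $n$ vertices, each edge present independently with probability $1/2$. *)

(* Defs.v *)
From HB Require Import structures.
From mathcomp Require Import all_boot all_order all_algebra.
From mathcomp Require Import reals.

Set Implicit Arguments.
Unset Strict Implicit.
Unset Printing Implicit Defensive.

Import Order.TTheory GRing.Theory Num.Theory.
Local Open Scope ring_scope.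

Definition vpairs (n : nat) : {set {set 'I_n}} := [set e : {set 'I_n} | #|e| == 2].

(* Simple labelled graphs on 'I_n, given by their edge sets. *)
Record sgraph (n : nat) := SGraph {
  edges : {set {set 'I_n}};
  edges_sub : edges \subset vpairs n }.

HB.instance Definition _ (n : nat) := [isSub for @edges n].
HB.instance Definition _ (n : nat) := [Finite of sgraph n by <:].

Definition is_clique (n : nat) (G : sgraph n) (A : {set 'I_n}) : bool :=
  [forall u in A, forall v in A, (u != v) ==> ([set u; v] \in edges G)].

Definition nb_cliques (n x : nat) (G : sgraph n) : nat :=
  #|[set A : {set 'I_n} | (#|A| == x) && is_clique G A]|.

(* The law of G(n,p): the product, over all vertex pairs, of Bernoulli(p)
   laws; [gnp_pr p E] is the probability that G ~ G(n,p) belongs to E. *)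
Definition gnp_mass (R : realType) (n : nat) (p : R) (G : sgraph n) : R :=
  \prod_(e in vpairs n) (if e \in edges G then p else 1 - p).

Definition gnp_pr (R : realType) (n : nat) (p : R) (E : {set sgraph n}) : R :=
  \sum_(G in E) gnp_mass p G.

(* Sanity check: edges are independent, each of probability p (the total
   mass is the case S = set0). *)
Lemma gnp_pr_edges (R : realType) (n : nat) (p : R) (S : {set {set 'I_n}}) :
  S \subset vpairs n ->
  gnp_pr p [set G : sgraph n | S \subset edges G] = p ^+ #|S|.
Proof.
move=> SV.
pose F (e : {set 'I_n}) : R := if e \in vpairs n then p else 0.
pose H (e : {set 'I_n}) : R :=
  if e \in vpairs n then (if e \in S then 0 else 1 - p) else 1.
have <- : \prod_e (F e + H e) = p ^+ #|S|.
  rewrite -prodr_const [RHS]big_mkcond; apply: eq_bigr => e _.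
  rewrite /F /H; case: ifPn => eV.
    by case: ifP => _; rewrite ?addr0 // addrC subrK.
  by rewrite add0r ifN //; apply: contra eV => /(subsetP SV).
rewrite bigA_distr /gnp_pr.
rewrite (bigID (fun J : {set {set 'I_n}} => (J \subset vpairs n) && (S \subset J))) /=.
rewrite [X in _ = _ + X]big1 ?addr0; last first.
  move=> J /nandP[/subsetPn[e eJ eV]|/subsetPn[e eS eJ]].
    by rewrite (bigD1 e) //= eJ /F (negPf eV) mul0r.
  by rewrite (bigD1 e) //= (negPf eJ) /H (subsetP SV) // eS mul0r.
rewrite (reindex_omap (val : sgraph n -> _) insub) /=; last first.
  by move=> J /andP[JV _]; rewrite insubT.
apply: eq_big => [G|G].
  by rewrite inE valK eqxx edges_sub andbT.
rewrite inE => SG; rewrite /gnp_mass big_mkcond; apply: eq_bigr => e _ /=.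
rewrite /F /H; case: ifPn => eV.
  case: ifPn => // eG; rewrite ifN //.
  by apply: contra eG => /(subsetP SG).
by rewrite ifN //; apply: contra eV => /(subsetP (edges_sub G)).
Qed.

(* Main.v *)
Require Import Defs.
From mathcomp Require Import all_boot all_order all_algebra.
From mathcomp Require Import reals sequences exp.
From mathcomp Require Import ring lra.
Import Order.TTheory GRing.Theory Num.Theory.
Local Open Scope ring_scope.

(** Expose the vertex pairs one at a time: adding one edge to a graph creates at
    most [C(n-2,x-2) <= D := x^2/x! n^(x-2)] new [x]-cliques, so the clique count
    has bounded differences in independent fair bits, and the allowed deviation
    is [c n D] with [c = e (2 - ln eps)].  An exponential Markov inequality for
    [N_x / (n D)], whose differences are at most [1/n] over at most [n^2/2] bits,
    bounds the probability by [2 exp (1/4 - c)], which is below [eps]. *)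

(** * Expectation over a uniformly random subset *)

Definition avg (R : realType) (T : finType) (V : {set T}) (f : {set T} -> R) : R :=
  (\sum_(A : {set T} | A \subset V) f A) / 2 ^+ #|V|.

Arguments avg {R T} V f.

Section Avg.
Variables (R : realType) (T : finType).
Implicit Types (V A : {set T}) (f g : {set T} -> R).

Lemma eq_avg V f g :
  (forall A, A \subset V -> f A = g A) -> avg V f = avg V g.
Proof. by move=> fg; rewrite /avg (eq_bigr g). Qed.

Lemma ler_avg V f g :
  (forall A, A \subset V -> f A <= g A) -> avg V f <= avg V g.
Proof.
by move=> fg; rewrite /avg ler_wpM2r ?invr_ge0 ?exprn_ge0 //; apply: ler_sum.
Qed.

Lemma avgD V f g : avg V (fun A => f A + g A) = avg V f + avg V g.
Proof. by rewrite /avg big_split mulrDl. Qed.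

Lemma avgZ V (c : R) f : avg V (fun A => c * f A) = c * avg V f.
Proof. by rewrite /avg -mulr_sumr mulrA. Qed.

Lemma avg_sum V (I : finType) (P : pred I) (F : I -> {set T} -> R) :
  avg V (fun A => \sum_(i | P i) F i A) = \sum_(i | P i) avg V (F i).
Proof. by rewrite /avg exchange_big mulr_suml. Qed.

Lemma avg_cst V (c : R) : avg V (fun=> c) = c.
Proof.
rewrite /avg sumr_const.
have -> : #|[pred A : {set T} | A \subset V]| = (2 ^ #|V|)%N.
  by rewrite -card_powerset; apply: eq_card => A; rewrite !inE.
by rewrite -[c *+ _]mulr_natr natrX mulfK // expf_neq0 // pnatr_eq0.
Qed.

(** Exposes the fair bit [a]: subsets of [a |: V] either avoid [a] or are [a |: A] for a unique
    subset [A] of [V]. *)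
Lemma avg_setU1 V f a : a \notin V ->
  avg (a |: V) f = avg V (fun A => (f A + f (a |: A)) / 2).
Proof.
move=> aV; rewrite /avg cardsU1 aV add1n exprS invfM mulrA; congr (_ / _).
rewrite -mulr_suml; congr (_ / _).
rewrite big_split /= (bigID (fun A : {set T} => a \in A)) /= addrC; congr (_ + _).
  apply: eq_bigl => A; apply/andP/idP => [[AaV aA]|AV].
    by rewrite -(setU1K aV) subsetD1 AaV.
  by rewrite (subset_trans AV) ?subsetUr //; split=> //; apply: contra aV => /(subsetP AV).
rewrite (reindex_onto (fun A => a |: A) (fun A => A :\ a)) /=; last first.
  by move=> A /andP[_ aA]; rewrite setD1K.
apply: eq_bigl => A; rewrite setU11 andbT.
apply/andP/idP => [[AaV /eqP eA]|AV].
  by rewrite -(setU1K aV) -eA setSD.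
by rewrite setUS // setU1K //; apply: contra aV => /(subsetP AV).
Qed.

End Avg.

(** * Exponential moments and tails under bounded differences *)

(** From 1 + z <= exp z, the sum is at most 1/(1 - y) + 1/(1 + y) = 2/(1 - y^2), and (1 - s)(1 + 2s)
    >= 1 for 0 <= s <= 1/2. *)
Lemma cosh_le (R : realType) (y : R) : y ^+ 2 <= 1 / 2 ->
  expR y + expR (- y) <= 2 * expR (2 * y ^+ 2).
Proof.
move=> y2.
have y1 : y < 1 by nra.
have yN1 : - 1 < y by nra.
have E1 : expR y <= (1 - y)^-1.
  by rewrite -[y in expR y]opprK expRN lef_pV2 ?posrE ?expR_gt0 ?subr_gt0 ?expR_ge1Dx.
have E2 : expR (- y) <= (1 + y)^-1.
  by rewrite expRN lef_pV2 ?posrE ?expR_gt0 ?expR_ge1Dx //; lra.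
have E3 := @expR_ge1Dx R (2 * y ^+ 2).
have E4 : (1 - y)^-1 + (1 + y)^-1 <= 2 * (1 + 2 * y ^+ 2).
  have -> : (1 - y)^-1 + (1 + y)^-1 = 2 / (1 - y ^+ 2).
    by field; apply/and3P; split; nra.
  by rewrite ler_pdivrMr; nra.
lra.
Qed.

(* The two values seen by one uniform bit are m - y and m + y, and
   averaging their exponentials gives exp m * cosh y. *)
Lemma avg_expR_le (R : realType) (T : finType) (V : {set T}) (f : {set T} -> R) (d : R) :
  0 <= d <= 1 ->
  (forall a (A : {set T}), a \in V -> A \subset V -> `|f (a |: A) - f A| <= d) ->
  avg V (expR \o f) <= expR (avg V f + #|V|%:R * (d ^+ 2 / 2)).
Proof.
move=> /andP[d0 d1].
(* The induction keeps [f] general, since exposing a bit replaces [f] by its average over that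
   bit. *)
elim: {V}#|V| {-2}V (erefl #|V|) f => [|k IHk] V cV f fd.
  have -> : V = set0 by apply/eqP; rewrite -cards_eq0 cV.
  have avg0 g : avg set0 g = g set0.
    by rewrite /avg cards0 divr1 (big_pred1 set0) // => A; rewrite subset0.
  by rewrite !avg0 cards0 mul0r addr0.
have [a aV] : exists a, a \in V by apply/card_gt0P; rewrite cV.
have aW : a \notin V :\ a by rewrite !inE eqxx.
have cW : #|V :\ a| = k by apply/eqP; rewrite -eqSS -cV (cardsD1 a V) aV.
have WV : V :\ a \subset V by apply: subD1set.
rewrite -(setD1K aV) !avg_setU1 // setD1K //.
set g := fun A => (f A + f (a |: A)) / 2.
(* An increment of [g] is the mean of two increments of [f]. *)
have gd b (A : {set T}) : b \in V :\ a -> A \subset V :\ a -> `|g (b |: A) - g A| <= d.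
  move=> bW AW; have bV := subsetP WV _ bW; have AV := subset_trans AW WV.
  have aAV : a |: A \subset V by rewrite subUset sub1set aV.
  have := fd _ _ bV AV; have := fd _ _ bV aAV.
  rewrite /g setUCA !ler_norml => /andP[? ?] /andP[? ?].
  by apply/andP; split; lra.
apply: (@le_trans _ _ (avg (V :\ a) (fun A => expR (d ^+ 2 / 2) * expR (g A)))).
  apply: ler_avg => A AW; have AV := subset_trans AW WV.
  have := fd _ _ aV AV.
  rewrite ler_norml => /andP[l1 l2].
  set y := (f (a |: A) - f A) / 2.
  have -> : (expR \o f) (a |: A) = expR (g A) * expR y.
    by rewrite -expRD /=; congr expR; rewrite /g /y; field.
  have -> : (expR \o f) A = expR (g A) * expR (- y).
    by rewrite -expRD /=; congr expR; rewrite /g /y; field.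
  rewrite -mulrDr addrC -mulrA [leRHS]mulrC ler_wpM2l ?expR_ge0 //.
  (* Since |y| <= d/2 and d <= 1, [cosh_le] applies, and its exponent 2y^2 is at most d^2/2. *)
  have y2 : 4 * y ^+ 2 <= d ^+ 2 by rewrite /y; nra.
  rewrite ler_pdivrMr // mulrC.
  apply: (le_trans (cosh_le _ _ _)); first by nra.
  by rewrite ler_pM2l // ler_expR; lra.
rewrite avgZ; apply: (@le_trans _ _ (expR (d ^+ 2 / 2) *
    expR (avg (V :\ a) g + #|V :\ a|%:R * (d ^+ 2 / 2)))).
  by rewrite ler_pM2l ?expR_gt0 // IHk // cW.
by rewrite -expRD ler_expR cW cV -natr1; lra.
Qed.

(** Exponential Markov inequality with parameter 1 for both tails; any scaling is left to the choice
    of [f]. *)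
Lemma avg_tail_lt (R : realType) (T : finType) (V : {set T}) (f : {set T} -> R) (d t : R) :
  0 <= d <= 1 ->
  (forall a (A : {set T}), a \in V -> A \subset V -> `|f (a |: A) - f A| <= d) ->
  avg V (fun A => (t < `|f A - avg V f|)%R%:R)
    <= 2 * expR (- t + #|V|%:R * (d ^+ 2 / 2)).
Proof.
move=> d01 fd; set m := avg V f.
have up : avg V (expR \o (fun A => f A - m)) <= expR (#|V|%:R * (d ^+ 2 / 2)).
  apply: le_trans (@avg_expR_le _ _ _ (fun A => f A - m) d d01 _) _.
    by move=> a A aV AV; rewrite opprB addrA subrK fd.
  by rewrite avgD avg_cst subrr add0r.
have dn : avg V (expR \o (fun A => -1 * f A + m)) <= expR (#|V|%:R * (d ^+ 2 / 2)).
  apply: le_trans (@avg_expR_le _ _ _ (fun A => -1 * f A + m) d d01 _) _.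
    move=> a A aV AV; rewrite -normrN.
    have -> : - (-1 * f (a |: A) + m - (-1 * f A + m)) = f (a |: A) - f A by ring.
    exact: fd.
  by rewrite avgD avg_cst avgZ mulN1r addNr add0r.
apply: (@le_trans _ _ (avg V (fun A => expR (- t) *
   ((expR \o (fun A => f A - m)) A + (expR \o (fun A => -1 * f A + m)) A)))).
  apply: ler_avg => A _ /=; rewrite mulrDr -!expRD.
  (* On the tail event one of the two exponents is positive, so its exponential exceeds 1. *)
  have [tA|_] := ltP; last by rewrite addr_ge0 ?expR_ge0.
  have e1 := @expR_gt0 R (- t + (f A - m)); have e2 := @expR_gt0 R (- t + (-1 * f A + m)).
  have := @expR_ge1Dx R (- t + (f A - m)); have := @expR_ge1Dx R (- t + (-1 * f A + m)).
  move: tA; rewrite ltr_normr => /orP[]; move=> ?; rewrite /=; lra.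
rewrite avgZ avgD expRD mulrCA ler_pM2l ?expR_gt0 //; lra.
Qed.

(** * G(n,1/2) as a uniformly random set of pairs *)

Lemma card_vpairs_sub (n : nat) (A : {set 'I_n}) :
  #|[set e in vpairs n | e \subset A]| = 'C(#|A|, 2).
Proof.
by rewrite -cards_draws; apply: eq_card => e; rewrite !inE andbC.
Qed.

Lemma card_vpairs (n : nat) : #|vpairs n| = 'C(n, 2).
Proof. by rewrite /vpairs card_draws card_ord. Qed.

Lemma is_cliqueE (n : nat) (G : sgraph n) (A : {set 'I_n}) :
  is_clique G A = ([set e in vpairs n | e \subset A] \subset edges G).
Proof.
apply/forall_inP/subsetP => [cA e|sA u uA].
  rewrite !inE => /andP[/cards2P[u [v [uv ->]]]].
  rewrite subUset !sub1set => /andP[uA vA].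
  by have /forall_inP/(_ v vA)/implyP/(_ uv) := cA u uA.
apply/forall_inP => v vA; apply/implyP => uv; apply: sA.
by rewrite !inE cards2 uv subUset !sub1set uA vA.
Qed.

(** Every graph has mass 2^-|[vpairs n]|, and [edges] is a bijection onto the subsets of
    [vpairs n]. *)
Lemma gnp_sum_half (R : realType) (n : nat) (f : {set {set 'I_n}} -> R) :
  \sum_(G : sgraph n) gnp_mass (1 / 2) G * f (edges G) = avg (vpairs n) f.
Proof.
rewrite /avg mulr_suml [RHS](reindex_omap (val : sgraph n -> _) insub) /=; last first.
  by move=> J JV; rewrite insubT.
apply: eq_big => [G|G _]; first by rewrite valK eqxx edges_sub.
rewrite mulrC; congr (_ * _); rewrite /gnp_mass.
rewrite (eq_bigr (fun=> 2^-1)) ?prodr_const ?exprVn // => e _.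
by case: ifP => _; field.
Qed.

Lemma gnp_pr_half (R : realType) (n : nat) (P : pred {set {set 'I_n}}) :
  gnp_pr (1 / 2 : R) [set G : sgraph n | P (edges G)] = avg (vpairs n) (fun J => (P J)%:R).
Proof.
rewrite -gnp_sum_half /gnp_pr big_mkcond; apply: eq_bigr => G _.
by rewrite inE; case: ifP; rewrite ?mulr1 ?mulr0.
Qed.

(** * Clique counts: mean and bounded differences *)

(** Taking any set of pairs, not an [sgraph], allows inserting a pair without a proof obligation. *)
Definition clique_count (n x : nat) (J : {set {set 'I_n}}) : nat :=
  #|[set A : {set 'I_n} | (#|A| == x) && ([set e in vpairs n | e \subset A] \subset J)]|.

Lemma nb_cliquesE (n x : nat) (G : sgraph n) :
  nb_cliques x G = clique_count n x (edges G).
Proof. by apply: eq_card => A; rewrite !inE is_cliqueE. Qed.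

(** Linearity of expectation: [gnp_pr_edges] gives each [x]-set probability 2^-C(x,2) of being a
    clique. *)
Lemma avg_clique_count (R : realType) (n x : nat) :
  avg (vpairs n) (fun J => (clique_count n x J)%:R : R) = 2 ^- 'C(x, 2) * ('C(n, x))%:R.
Proof.
pose S (A : {set 'I_n}) := [set e in vpairs n | e \subset A].
transitivity (avg (vpairs n) (fun J => \sum_(A : {set 'I_n} | #|A| == x) (S A \subset J)%:R : R)).
  apply: eq_avg => J _; rewrite /clique_count -sum1_card natr_sum [RHS]big_mkcond /= big_mkcond.
  by apply: eq_bigr => A _; rewrite inE /S; case: (#|A| == x) => //=; case: ifP.
rewrite avg_sum (eq_bigr (fun=> 2 ^- 'C(x, 2))) => [|A /eqP cA].
  by rewrite sumr_const -cardsE card_draws card_ord mulr_natr.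
rewrite -(gnp_pr_half _ _ (fun J => S A \subset J)) gnp_pr_edges.
  by rewrite card_vpairs_sub cA div1r exprVn.
by apply/subsetP => e; rewrite inE => /andP[].
Qed.

(** A new clique must contain both ends of [a]; removing them injects such sets into the
    (x-2)-subsets of the complement of [a]. *)
Lemma clique_countU1 (n x : nat) (a : {set 'I_n}) (J : {set {set 'I_n}}) :
  a \in vpairs n -> (1 < x)%N ->
  (clique_count n x J <= clique_count n x (a |: J)
     <= clique_count n x J + 'C(n - 2, x - 2))%N.
Proof.
rewrite inE => /eqP ca x1; apply/andP; split.
  apply/subset_leq_card/subsetP => A; rewrite !inE => /andP[-> AJ] /=.
  exact: subset_trans AJ (subsetUr _ _).
set X := [set A : {set 'I_n} | (#|A| == x) && (a \subset A)].
have cX : (#|X| <= 'C(n - 2, x - 2))%N.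
  have <- : #|~: a| = (n - 2)%N by rewrite cardsCs setCK ca card_ord.
  rewrite -cards_draws -(card_in_imset (f := fun A => A :\: a)).
    apply/subset_leq_card/subsetP => _ /imsetP[A + ->].
    rewrite !inE => /andP[/eqP cA aA]; rewrite cardsDS // cA ca eqxx andbT.
    by rewrite setDE subsetIr.
  move=> A B; rewrite !inE => /andP[_ aA] /andP[_ aB] AB.
  by rewrite -(setID A a) -(setID B a) AB (setIidPr aA) (setIidPr aB).
apply: leq_trans (leq_add (leqnn _) cX).
apply: leq_trans (leq_card_setU _ _); apply/subset_leq_card/subsetP => A.
rewrite !inE => /andP[-> /subsetP AJ] /=.
case: (boolP (a \subset A)) => [|aA]; rewrite ?orbT // orbF.
apply/subsetP => e eA; have := AJ _ eA; rewrite !inE => /orP[/eqP ea|//].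
by move: eA; rewrite !inE ea (negPf aA) andbF.
Qed.

(** * Numerical estimates *)

Lemma bin_le_pow (R : realType) (n x : nat) : (1 < x)%N ->
  ('C(n - 2, x - 2))%:R <= x%:R ^+ 2 / (x`!)%:R * n%:R ^+ (x - 2) :> R.
Proof.
case: x => [|[|k]] // _; rewrite !subSS subn0.
rewrite mulrAC ler_pdivlMr ?ltr0n ?fact_gt0 // -!natrX -!natrM ler_nat.
rewrite !factS mulnCA (mulnCA 'C(_, _)) mulnA bin_ffact leq_mul //.
  by rewrite -mulnn leq_mul.
rewrite ffact_prod -[in leqRHS](card_ord k) -prod_nat_const.
by apply: leq_prod => i _; rewrite -subnDA leq_subr.
Qed.

(** As e >= 2 and ln eps < 0, the exponent is at most ln eps - 15/4, and exp (15/4) >= 19/4 > 2. *)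
Lemma two_expR_lt (R : realType) (eps : R) : 0 < eps -> eps < 1 ->
  2 * expR (- (expR 1 * (2 - ln eps)) + 1 / 4) < eps.
Proof.
move=> e0 e1.
have l0 : ln eps < 0 by rewrite ln_lt0 // e0.
have e2 := @expR_ge1Dx R 1.
apply: (@le_lt_trans _ _ (2 * expR (ln eps - 15 / 4))).
  by rewrite ler_pM2l // ler_expR; nra.
rewrite expRD lnK ?posrE // mulrCA gtr_pMr //.
have h : 2 < expR (15 / 4 : R) by apply: lt_le_trans (expR_ge1Dx _); lra.
by rewrite expRN ltr_pdivrMr ?expR_gt0 // mul1r.
Qed.

Theorem mainTheorem3 (R : realType) (eps : R) (n x : nat) :
  let e : R := expR 1 in
  0 < eps -> eps < 1 ->
  x%:R ^+ 2 * (2 * e - e * ln eps) * (2 * e + 2 - e * ln eps) < n%:R ->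
  gnp_pr (1 / 2)
    [set G : sgraph n |
      e * (2 - ln eps) * (x%:R ^+ 2 / (x`!)%:R) * n%:R ^ (x%:Z - 1)
        < `| (nb_cliques x G)%:R - 2 ^- 'C(x, 2) * ('C(n, x))%:R |]
  < eps.
Proof.
move=> e eps0 eps1 hn.
set c := e * (2 - ln eps).
have l0 : ln eps < 0 by rewrite ln_lt0 // eps0.
have e_gt0 : 0 < e by apply: expR_gt0.
have c0 : 0 < c by rewrite mulr_gt0 // subr_gt0; lra.
(* The left side of [hn] is nonnegative. *)
have n0 : 0 < n%:R :> R.
  apply: le_lt_trans hn; apply: mulr_ge0; first apply: mulr_ge0; [exact: sqr_ge0| |]; nra.
set D : R := x%:R ^+ 2 / (x`!)%:R * n%:R ^+ (x - 2).
set F := fun J : {set {set 'I_n}} => (clique_count n x J)%:R : R.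
have mF : avg (vpairs n) F = 2 ^- 'C(x, 2) * ('C(n, x))%:R := avg_clique_count R n x.
set t := _ * n%:R ^ _.
have -> : [set G : sgraph n | t < `|(nb_cliques x G)%:R - 2 ^- 'C(x, 2) * 'C(n, x)%:R|]
   = [set G : sgraph n | t < `|F (edges G) - avg (vpairs n) F|].
  by apply/setP => G; rewrite !inE mF nb_cliquesE.
rewrite (gnp_pr_half _ _ (fun J => t < `|F J - avg (vpairs n) F|)).
(* If x <= 1, an [x]-set contains no pair, so the count is constant and the event, a strict
   inequality with t >= 0, is empty. *)
have [x1|x1] := ltnP 1 x; last first.
  have Fc J : F J = avg (vpairs n) F.
    have Fcst K : F K = F set0.
      rewrite /F; congr _%:R; apply: eq_card => A; rewrite !inE.
      case: eqP => //= cA; have -> : [set e in vpairs n | e \subset A] = set0.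
        by apply/eqP; rewrite -cards_eq0 card_vpairs_sub cA bin_small.
      by rewrite !sub0set.
    by rewrite -[LHS](avg_cst R _ (vpairs n)); apply: eq_avg => K _; rewrite !Fcst.
  rewrite (eq_avg _ _ _ _ (fun=> 0)) ?avg_cst // => J _.
  rewrite Fc subrr normr0 ltNge /t mulr_ge0 ?exprz_ge0 ?(ltW n0) //.
  by rewrite mulr_ge0 ?(ltW c0) // divr_ge0 ?ler0n ?sqr_ge0.
have D0 : 0 < D.
  by rewrite /D mulr_gt0 ?exprn_gt0 // divr_gt0 ?exprn_gt0 ?ltr0n ?fact_gt0 // (ltnW x1).
(* For x > 1 the integer exponent x - 1 is the natural number (x - 2) + 1. *)
have tE : t = c * (n%:R * D).
  rewrite /t /D -[LHS]mulrA; congr (_ * _); rewrite [RHS]mulrCA -exprS; congr (_ * _).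
  by rewrite (subnSK x1) (subzn (ltnW x1)).
have nD0 : 0 < n%:R * D by rewrite mulr_gt0.
(* This scaling turns the threshold [t] into [c] and the difference bound [D] into 1/n. *)
pose f J := (n%:R * D)^-1 * F J.
have mf : avg (vpairs n) f = (n%:R * D)^-1 * avg (vpairs n) F by rewrite avgZ.
rewrite (eq_avg _ _ _ _ (fun J => (c < `|f J - avg (vpairs n) f|)%R%:R)); last first.
  move=> J _; rewrite mf -mulrBr normrM gtr0_norm ?invr_gt0 //.
  by rewrite mulrC ltr_pdivlMr // tE.
have d01 : 0 <= (n%:R^-1 : R) <= 1.
  by rewrite invr_ge0 ler0n /= invf_le1 // ler1n -(ltr0n R).
apply: le_lt_trans (avg_tail_lt _ _ _ _ _ _ d01 _) _.
  move=> a J aV _; rewrite -mulrBr normrM gtr0_norm ?invr_gt0 //.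
  rewrite invfM -mulrA ler_piMr ?invr_ge0 ?ler0n // mulrC ler_pdivrMr // mul1r.
  apply: le_trans (bin_le_pow R n x x1).
  have /andP[h1 h2] := clique_countU1 n x a J aV x1.
  by rewrite ger0_norm ?subr_ge0 ?ler_nat // lerBlDl -natrD ler_nat.
apply: le_lt_trans (two_expR_lt R eps eps0 eps1).
rewrite ler_pM2l // ler_expR lerD2l card_vpairs.
(* Hence C(n,2) bits with d = 1/n contribute at most 1/4 to the exponent. *)
have : ('C(n, 2))%:R <= n%:R ^+ 2 / 2 :> R.
  rewrite ler_pdivlMr // -natrX -natrM ler_nat bin2 muln2.
  by apply: (@leq_trans (n * n.-1)); rewrite -?geq_half_double // -mulnn leq_mul // leq_pred.
move=> hC; rewrite exprVn mulrA ler_pdivrMr // ler_pdivrMr ?exprn_gt0 //; lra.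
Qed.
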